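(* The genus-$0$ $\widetilde L_1$ constraint holds: $\widetilde\Psi_{0,1}=0$ identically, where $$\widetilde\Psi_{0,1}:=-\sum_{m,\alpha}\tilde t^\alpha_m\langle\langle\tau_{m+1}(\mathcal O_\alpha)\rangle\rangle_0+\frac12\sum_\alpha\langle\langle\mathcal O_\alpha\rangle\rangle_0\langle\langle\mathcal O^\alpha\rangle\rangle_0 .$$
   Context: Setting. $V$ is a smooth projective variety of complex dimension $d$ or, more generally, a compact symplectic manifold of real dimension $2d$ (e.g. semi-positive) whose genus-$0$ Gromov-Witten invariants are defined and satisfy the equations (S), (D), (L), (T) below. Only even dimensional cohomology classes are considered ($H^*(V,\mathbb Q)$ denotes the even cohomology). Fix a homogeneous basis $\mathcal O_1,\dots,\mathcal O_N$ of $H^*(V,\mathbb Q)$ with $\mathcal O_1=1$ and non-decreasing degrees. Greek indices range over $1,\dots,N$; summation indices $m$ range over the non-negative integers. Put $\eta_{\alpha\beta}=\int_V\mathcal O_\alpha\cup\mathcal O_\beta$, $(\eta^{\alpha\beta})=(\eta_{\alpha\beta})^{-1}$, $\mathcal O^\alpha=\sum_\beta\eta^{\alpha\beta}\mathcal O_\beta$, $q_\alpha=\frac12\deg\mathcal O_\alpha$ (half the real degree), $b_\alpha=q_\alpha-\frac12(d-1)$. The matrix $\mathcal C=(\mathcal C_\alpha^\beta)$ is defined by $c_1(V)\cup\mathcal O_\alpha=\sum_\beta\mathcal C_\alpha^\beta\mathcal O_\beta$, and $\mathcal C_{\alpha\beta}=\sum_\gamma\mathcal C_\alpha^\gamma\eta_{\gamma\beta}$.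 Free energy. Genus-$0$ correlators are $\langle\tau_{n_1}(\mathcal O_{\alpha_1})\cdots\tau_{n_k}(\mathcal O_{\alpha_k})\rangle_0=\sum_{A\in H_2(V,\mathbb Z)}q^A\int_{[\overline{\mathcal M}_{0,k}(V,A)]^{\rm virt}}\prod_{i=1}^k c_1(E_i)^{n_i}\cup{\rm ev}_i^*\mathcal O_{\alpha_i}$, where $E_i$ is the line bundle whose fiber is the cotangent line at the $i$-th marked point and $q^A$ lies in the Novikov ring. The genus-$0$ free energy is the formal power series $F_0=\langle\exp\sum_{n,\alpha}t^\alpha_n\tau_n(\mathcal O_\alpha)\rangle_0$ in the variables $t^\alpha_m$ ($m\ge0$, $1\le\alpha\le N$). Put $\tilde t^\alpha_m=t^\alpha_m-\delta_{m,1}\delta_{\alpha,1}$. The operator $\tau_m(\mathcal O_\alpha)$ is identified with the vector field $\partial/\partial t^\alpha_m$, $\tau_0(\mathcal O_\alpha)=\mathcal O_\alpha$, and $\tau_m(\mathcal O_\alpha)=0$ for $m<0$. The correlation functions are $\langle\langle\tau_{m_1}(\mathcal O_{\alpha_1})\cdots\tau_{m_k}(\mathcal O_{\alpha_k})\rangle\rangle_0=\frac{\partial^k F_0}{\partial t^{\alpha_1}_{m_1}\cdots\partial t^{\alpha_k}_{m_k}}$, extended multilinearly over functions. Standing equations for $V$: (S) string: $\sum_{m,\alpha}\tilde t^\alpha_m\langle\langle\tau_{m-1}(\mathcal O_\alpha)\rangle\rangle_0=-\frac12\sum\eta_{\alpha\beta}t^\alpha_0t^\beta_0$. (D) dilaton: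 $\sum_{m,\alpha}\tilde t^\alpha_m\langle\langle\tau_m(\mathcal O_\alpha)\rangle\rangle_0=2F_0$. (L) Hori's equation: $\sum_{m,\alpha}(m+b_\alpha)\tilde t^\alpha_m\langle\langle\tau_m(\mathcal O_\alpha)\rangle\rangle_0+\sum_{m,\alpha,\beta}\mathcal C_\alpha^\beta\tilde t^\alpha_m\langle\langle\tau_{m-1}(\mathcal O_\beta)\rangle\rangle_0=-\frac12\sum\mathcal C_{\alpha\beta}t^\alpha_0t^\beta_0$. (T) genus-$0$ topological recursion: for $m>0$, $\langle\langle\tau_m(\mathcal O_\alpha)\tau_n(\mathcal O_\beta)\tau_k(\mathcal O_\gamma)\rangle\rangle_0=\sum_\sigma\langle\langle\tau_{m-1}(\mathcal O_\alpha)\mathcal O_\sigma\rangle\rangle_0\langle\langle\mathcal O^\sigma\tau_n(\mathcal O_\beta)\tau_k(\mathcal O_\gamma)\rangle\rangle_0$. *)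

(* Defs.v *)
From HB Require Import structures.
From mathcomp Require Import all_boot all_order all_fingroup all_algebra all_field.
From mathcomp Require Import finmap multiset.
From mathcomp Require Import all_classical all_reals lra zify.

Set Implicit Arguments.
Unset Strict Implicit.
Unset Printing Implicit Defensive.

Import Order.TTheory GRing.Theory Num.Theory.
Local Open Scope classical_set_scope.
Local Open Scope ring_scope.

(* Convolution over a commutative monoid (M, op, e): the common source of the
   product of the Novikov ring and of the product of formal power series.
   The sum is the library's sum over the (finite) support of the summand. *)
Section Convolution.
Variables (M : choiceType) (op : M -> M -> M) (e : M) (R : comNzRingType).
Implicit Types f g h : M -> R.

Definition conv f g : M -> R :=
  fun x => \sum_(p \in [set p : M * M | op p.1 p.2 = x]) f p.1 * g p.2.

Definition conv1 : M -> R := fun x => (x == e)%:R.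

Definition conv_bound2 (s : seq M) f g x := forall a b,
  op a b = x -> f a != 0 -> g b != 0 -> a \in s /\ b \in s.

Definition conv_bound3 (s : seq M) f g h x := forall a b c,
  op (op a b) c = x -> f a != 0 -> g b != 0 -> h c != 0 ->
  [/\ a \in s, b \in s & c \in s].

Lemma convE (s : seq M) f g x : uniq s -> conv_bound2 s f g x ->
  conv f g x = \sum_(a <- s) \sum_(b <- s) (op a b == x)%:R * (f a * g b).
Proof.
move=> us bnd; rewrite /conv fsbig_mkcond (fsbigTE [fset p in allpairs pair s s]%fset).
  rewrite (perm_big (allpairs pair s s)) /=; last first.
    apply: uniq_perm => //; first exact: fset_uniq.
      by apply: allpairs_uniq => // -[? ?] [? ?] _ _ [-> ->].
    by move=> p; rewrite !inE.
  rewrite big_allpairs; apply: eq_bigr => a _; apply: eq_bigr => b _.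
  rewrite /patch; case: (eqVneq (op a b) x) => [E|E].
    by rewrite mem_set //= mul1r.
  by rewrite mul0r memNset //= => /eqP; rewrite (negbTE E).
move=> [a b]; rewrite inE /= /patch; case: ifPn => //; rewrite inE /= => E nin.
apply/eqP; apply: contraR nin => nz; apply/allpairsP; exists (a, b) => /=.
have [fa gb] : f a != 0 /\ g b != 0.
  by split; apply: contra_neq nz => ->; rewrite ?mul0r ?mulr0.
by have [] := bnd a b E fa gb.
Qed.

Lemma conv_neq0 f g x : conv f g x != 0 ->
  exists a b, [/\ op a b = x, f a != 0 & g b != 0].
Proof.
move=> nz; apply: contrapT => H; move/eqP: nz; apply.
apply: fsbig1 => -[a b] /= E.
case: (eqVneq (f a) 0) => [->|fa]; first by rewrite mul0r.
case: (eqVneq (g b) 0) => [->|gb]; first by rewrite mulr0.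
by case: H; exists a, b.
Qed.

Lemma convDl (s : seq M) f g h x :
    conv_bound2 s f h x -> conv_bound2 s g h x ->
  conv (fun y => f y + g y) h x = conv f h x + conv g h x.
Proof.
move=> b1 b2; have b1' : conv_bound2 (undup s) f h x.
  by move=> a b E fa hb; rewrite !mem_undup; apply: b1.
have b2' : conv_bound2 (undup s) g h x.
  by move=> a b E fa hb; rewrite !mem_undup; apply: b2.
rewrite !(@convE (undup s)) ?undup_uniq //.
  rewrite -big_split; apply: eq_bigr => a _ /=; rewrite -big_split.
  by apply: eq_bigr => b _ /=; rewrite -mulrDr mulrDl.
move=> a b E fga hb; case: (eqVneq (f a) 0) => fa; last exact: b1'.
by apply: b2' => //; move: fga; rewrite fa add0r.
Qed.

Lemma convZl (phi : R -> R) (s : seq M) f g x :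
    phi 0 = 0 -> {morph phi : u v / u + v} ->
    (forall u v, phi (u * v) = phi u * v) -> conv_bound2 s f g x ->
  conv (fun y => phi (f y)) g x = phi (conv f g x).
Proof.
move=> phi0 phiD phiM b0; have b1 : conv_bound2 (undup s) f g x.
  by move=> a b E fa hb; rewrite !mem_undup; apply: b0.
rewrite !(@convE (undup s)) ?undup_uniq //.
  rewrite (big_morph phi phiD phi0); apply: eq_bigr => a _.
  rewrite (big_morph phi phiD phi0); apply: eq_bigr => b _.
  case: (op a b == x); first by rewrite !mul1r phiM.
  by rewrite !mul0r phi0.
move=> a b E fa gb; apply: b1 => //.
by apply: contra_neq fa => ->; rewrite phi0.
Qed.

Hypothesis opC : commutative op.
Hypothesis opA : associative op.
Hypothesis op1 : left_id e op.

Lemma convC f g : conv f g = conv g f.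
Proof.
apply/funext => x; rewrite /conv.
rewrite (reindex_fsbig (fun p : M * M => (p.2, p.1))
   [set p : M * M | op p.1 p.2 = x]).
  by apply: eq_fsbigr => -[a b] _ /=; rewrite mulrC.
split.
- by move=> [a b] /=; rewrite opC.
- by move=> [a b] [c d] _ _ /= [-> ->].
- by move=> [a b] /= E; exists (b, a) => //=; rewrite opC.
Qed.

Lemma conv1l f : conv conv1 f = f.
Proof.
apply/funext => x.
pose s := undup [:: e; x]; have us : uniq s := undup_uniq _.
have se : e \in s by rewrite mem_undup mem_head.
have sx : x \in s by rewrite mem_undup !inE eqxx orbT.
rewrite (@convE s) //; last first.
  move=> a b; rewrite /conv1; case: (eqVneq a e) => [->|]; rewrite ?eqxx //.
  by rewrite op1 => ->.
rewrite (bigD1_seq e) //= [X in _ + X]big1 => [|a ane].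
  rewrite addr0 (bigD1_seq x) //= [X in _ + X]big1 => [|b bne].
    by rewrite addr0 op1 /conv1 !eqxx !mul1r.
  by rewrite op1 (negbTE bne) mul0r.
by apply: big1 => b _; rewrite /conv1 (negbTE ane) mul0r mulr0.
Qed.

Let conv3 (s : seq M) f g h x : conv_bound3 s f g h x ->
  let s' := undup (s ++ [seq op a b | a <- s, b <- s]) in
  conv (conv f g) h x = \sum_(a <- s') \sum_(b <- s') \sum_(c <- s')
     (op (op a b) c == x)%:R * (f a * g b * h c).
Proof.
move=> bnd s'.
have us' : uniq s' by exact: undup_uniq.
have mems a : a \in s -> a \in s'.
  by move=> sa; rewrite mem_undup mem_cat sa.
have memop a b : a \in s -> b \in s -> op a b \in s'.
  by move=> sa sb; rewrite mem_undup mem_cat allpairs_f ?orbT.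
rewrite (@convE s') //; last first.
  move=> y c E /conv_neq0[a [b [ab fa gb]]] hc.
  rewrite -ab in E; have [sa sb sc] := bnd a b c E fa gb hc.
  by rewrite -ab memop // mems.
have -> : \sum_(y <- s') \sum_(c <- s') (op y c == x)%:R * (conv f g y * h c)
   = \sum_(y <- s') \sum_(c <- s') \sum_(a <- s') \sum_(b <- s')
      (op a b == y)%:R * ((op y c == x)%:R * (f a * g b * h c)).
  apply: eq_bigr => y _; apply: eq_bigr => c _.
  case: (eqVneq (op y c) x) => [E|_]; last first.
    rewrite mul0r big1 // => a _; rewrite big1 // => b _.
    by rewrite mul0r mulr0.
  case: (eqVneq (h c) 0) => [->|hc].
    rewrite !mulr0 big1 // => a _; rewrite big1 // => b _.
    by rewrite !mulr0.
  rewrite mul1r (@convE s') // => [|a b ab fa gb].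
    rewrite mulr_suml; apply: eq_bigr => a _; rewrite mulr_suml.
    by apply: eq_bigr => b _; rewrite mul1r !mulrA.
  by rewrite -ab in E; have [/mems ? /mems ? _] := bnd a b c E fa gb hc.
under eq_bigr do rewrite exchange_big /=.
rewrite exchange_big /=; apply: eq_bigr => a _.
under eq_bigr do rewrite exchange_big /=.
rewrite exchange_big /=; apply: eq_bigr => b _.
rewrite exchange_big /=; apply: eq_bigr => c _.
have [sab|nsab] := boolP (op a b \in s').
  rewrite (bigD1_seq (op a b)) //= eqxx mul1r big1 ?addr0 // => y /negbTE.
  by rewrite eq_sym => ->; rewrite mul0r.
rewrite big_seq big1 => [|y sy]; last first.
  by case: eqVneq => [E|_]; [rewrite E sy in nsab|rewrite mul0r].
case: eqVneq => [E|_]; last by rewrite mul0r.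
case: (eqVneq (f a) 0) => [->|fa]; first by rewrite !mul0r mulr0.
case: (eqVneq (g b) 0) => [->|gb]; first by rewrite mulr0 mul0r mulr0.
case: (eqVneq (h c) 0) => [->|hc]; first by rewrite !mulr0.
by have [sa sb _] := bnd a b c E fa gb hc; rewrite memop in nsab.
Qed.

Lemma convA (s : seq M) f g h x : conv_bound3 s f g h x ->
  conv f (conv g h) x = conv (conv f g) h x.
Proof.
move=> bnd; rewrite convC (convC g h) (conv3 bnd) (@conv3 s); last first.
  move=> c b a; rewrite -opA opC (opC b) => E hc gb fa.
  by have [] := bnd a b c E fa gb hc.
rewrite exchange_big /=; under eq_bigr do rewrite exchange_big /=.
rewrite exchange_big /=; apply: eq_bigr => a _; apply: eq_bigr => b _.
apply: eq_bigr => c _; rewrite opC (opC c) opA; congr (_ * _).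
by rewrite mulrC (mulrC (h c)) mulrA.
Qed.

End Convolution.

(* Novikov ring of a lattice H2 graded by an energy omega: formal sums
   \sum_A f(A) q^A such that only finitely many classes of energy <= c occur,
   for every c.  An element is represented by its coefficient function. *)
Section Novikov.
Variables (R : realType) (H2 : zmodType) (omega : {additive H2 -> R}).

Definition novikov_finite : {pred (H2 -> rat^o)} :=
  fun f => `[< forall c : R, finite_set [set A | f A != 0 /\ omega A <= c] >].

Record novikov := Novikov {
  nov_coef :> H2 -> rat^o;
  nov_coefP : nov_coef \in novikov_finite }.

HB.instance Definition _ := [isSub for nov_coef].
HB.instance Definition _ := [Choice of novikov by <:].

Lemma novikov_finiteP f : reflect
  (forall c : R, finite_set [set A | f A != 0 /\ omega A <= c])
  (f \in novikov_finite).
Proof. exact: asboolP. Qed.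

Lemma novikov_submod : submod_closed novikov_finite.
Proof.
split=> [|k f g /novikov_finiteP ff /novikov_finiteP fg].
  apply/novikov_finiteP => c; apply: (sub_finite_set (B := set0)) => // A [].
  by rewrite (_ : 0 A = 0) // eqxx.
apply/novikov_finiteP => c.
apply: (@sub_finite_set _ _
  ([set A | f A != 0 /\ omega A <= c] `|` [set A | g A != 0 /\ omega A <= c])).
  move=> A [+ cA] /=; rewrite !fctE.
  case: (eqVneq (f A) 0) => [->|]; last by left.
  by rewrite scaler0 add0r; right.
by rewrite finite_setU; split.
Qed.

HB.instance Definition _ :=
  GRing.isSubmodClosed.Build rat (H2 -> rat^o) novikov_finite
    (GRing.submod_closed_semi novikov_submod).
HB.instance Definition _ :=
  [SubChoice_isSubLmodule of novikov by <:].

Let supp (f : novikov) (c : R) : set H2 := [set A | f A != 0 /\ omega A <= c].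

Let fin_supp f c : finite_set (supp f c).
Proof. by have /novikov_finiteP := nov_coefP f; apply. Qed.

Let low (f : novikov) :
  exists2 m : R, m <= 0 & forall A, f A != 0 -> m <= omega A.
Proof.
have low_seq (s : seq H2) :
    exists2 m : R, m <= 0 & forall A, A \in s -> m <= omega A.
  elim: s => [|B s [m m0 lem]]; first by exists 0.
  exists (Order.min (omega B) m) => [|A]; first by rewrite ge_min m0 orbT.
  rewrite inE => /orP[/eqP->|/lem]; first by rewrite ge_min lexx.
  by move=> leA; rewrite ge_min leA orbT.
have [m m0 lem] := low_seq (fset_set (supp f 0)).
exists m => // A fA; have [le0|/ltW ge0] := leP (omega A) 0.
  by apply: lem; rewrite in_fset_set //; apply: mem_set.
exact: le_trans ge0.
Qed.

Let bound3 (f g h : novikov) A : exists s, conv_bound3 +%R s f g h A.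
Proof.
have [mf mf0 lf] := low f; have [mg mg0 lg] := low g; have [mh mh0 lh] := low h.
pose c := omega A - mf - mg - mh.
exists (fset_set (supp f c) ++ fset_set (supp g c) ++ fset_set (supp h c)).
move=> a b d E fa gb hd; have la := lf a fa; have lb := lg b gb.
have ld := lh d hd; have := congr1 omega E; rewrite !raddfD /= => EA.
have [ca cb cd] : [/\ omega a <= c, omega b <= c & omega d <= c].
  by rewrite /c; split; lra.
split; rewrite !mem_cat; apply/or3P; [apply: Or31|apply: Or32|apply: Or33];
  by rewrite in_fset_set //; apply: mem_set.
Qed.

Let bound2 (f g : novikov) A : exists s, conv_bound2 +%R s f g A.
Proof.
have [m m0 lem] := low f; have [n n0 len] := low g.
pose c := omega A - m - n.
exists (fset_set (supp f c) ++ fset_set (supp g c)).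
move=> a b E fa gb; have la := lem a fa; have lb := len b gb.
have := congr1 omega E; rewrite !raddfD /= => EA.
have [ca cb] : omega a <= c /\ omega b <= c by rewrite /c; split; lra.
split; rewrite !mem_cat; apply/orP; [left|right];
  by rewrite in_fset_set //; apply: mem_set.
Qed.

Lemma novikov_mul_finite (f g : novikov) : conv +%R f g \in novikov_finite.
Proof.
apply/novikov_finiteP => c.
have [m m0 lem] := low f; have [n n0 len] := low g.
apply: (@sub_finite_set _ _ ((fun p : H2 * H2 => p.1 + p.2) @`
  (supp f (c - n) `*` supp g (c - m)))); last first.
  by apply: finite_image; apply: finite_setX.
move=> A /= [/conv_neq0[a [b [E fa gb]]] Ac].
have la := lem a fa; have lb := len b gb.
have := congr1 omega E; rewrite !raddfD /= => EA.
by exists (a, b) => //=; split; split=> //=; lra.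
Qed.

Lemma novikov_one_finite : conv1 0 rat \in novikov_finite.
Proof.
apply/novikov_finiteP => c; apply: (sub_finite_set (B := [set 0])).
  by move=> A []; rewrite /conv1; case: (eqVneq A 0) => [->|_]; rewrite ?eqxx.
exact: finite_set1.
Qed.

Definition novikov_one : novikov := Novikov novikov_one_finite.
Definition novikov_mul (f g : novikov) : novikov :=
  Novikov (novikov_mul_finite f g).

Lemma novikov_ext (f g : novikov) : nov_coef f =1 nov_coef g -> f = g.
Proof. by move=> fg; apply: val_inj; apply/funext. Qed.

Let mulA : associative novikov_mul.
Proof.
move=> f g h; apply: novikov_ext => A /=; have [s bs] := bound3 f g h A.
exact: (convA (@addrC _) (@addrA _) bs).
Qed.

Let mulC : commutative novikov_mul.
Proof. by move=> f g; apply: val_inj => /=; apply: convC; apply: addrC. Qed.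

Let mul1 : left_id novikov_one novikov_mul.
Proof. by move=> f; apply: val_inj => /=; apply: conv1l; apply: add0r. Qed.

Let mulD : left_distributive novikov_mul +%R.
Proof.
move=> f g h; apply: novikov_ext => A /=.
have [s bs] := bound2 f h A; have [t bt] := bound2 g h A.
apply: (@convDl _ _ _ (s ++ t)) => a b E fa hb.
  by have [? ?] := bs a b E fa hb; rewrite !mem_cat; split; apply/orP; left.
by have [? ?] := bt a b E fa hb; rewrite !mem_cat; split; apply/orP; right.
Qed.

Let one_neq0 : novikov_one != 0.
Proof.
apply/eqP => /(congr1 (fun f : novikov => nov_coef f 0)).
by rewrite /= /conv1 eqxx.
Qed.

HB.instance Definition _ :=
  GRing.Zmodule_isComNzRing.Build novikov mulA mulC mul1 mulD one_neq0.

Let scalAl (k : rat) (f g : novikov) : k *: (f * g) = (k *: f) * g.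
Proof.
apply: novikov_ext => A; have [s bs] := bound2 f g A.
by rewrite -[RHS]/(conv +%R (fun B => k * f B) g A)
  (convZl (mulr0 k) (mulrDr k) (mulrA k) bs).
Qed.

HB.instance Definition _ := GRing.Lmodule_isLalgebra.Build rat novikov scalAl.
HB.instance Definition _ := GRing.Lalgebra_isComAlgebra.Build rat novikov.

End Novikov.

(* Formal power series in the variables t_i, i : I; the monomial
   \prod_i t_i^(K i) is the multiset K, and f K is its coefficient in f.  The
   library equips plain functions with the pointwise product; fps, although
   convertible to a function type, carries the product of power series. *)
Definition fps (I : choiceType) (L : comAlgType rat) : Type :=
  {mset I}%mset -> L.

Section Fps.
Variables (I : choiceType) (L : comAlgType rat).
Local Notation fps := (fps I L).
Local Notation monom := {mset I}%mset.

HB.instance Definition _ := Choice.copy fps (monom -> L).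
HB.instance Definition _ := GRing.Lmodule.copy fps (monom -> L).

Let addmC : commutative (@msetD I).
Proof. exact: msetDC. Qed.

Let addmA : associative (@msetD I).
Proof. exact: msetDA. Qed.

Let add0m : left_id mset0 (@msetD I).
Proof. exact: mset0D. Qed.

Let divisors_ex (K : monom) :
  exists s : seq monom, forall A B, msetD A B = K -> A \in s.
Proof.
suff H (r : seq I) : exists s : seq monom,
    forall A B, msetD A B = seq_mset r -> A \in s.
  by have [s sP] := H K; exists s => A B E; apply: (sP A B); rewrite seq_mset_id.
elim: r => [|x r [s sP]].
  exists [:: mset0] => A B E; rewrite inE; apply/eqP/msetP => y.
  have := congr1 (fun C : monom => C y) E; rewrite msetE2 mset_seqE mset0E /=.
  by case: (A y).
exists (s ++ map (msetD [mset x]%mset) s) => A B E; rewrite mem_cat; apply/orP.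
have EC y := congr1 (fun C : monom => C y) E.
have [xA|xA] := boolP (x \in A); [right|left].
  apply/mapP; exists (A `\ x)%mset; last by rewrite msetB1K.
  apply: (sP _ B); apply/msetP => y; have := EC y.
  rewrite !msetE2 !mset_seqE /= msetnE eq_sym.
  case: (eqVneq x y) => [<-|_] /=; last by rewrite subn0.
  by move: xA; rewrite in_mset; lia.
have xB : x \in B.
  have := EC x; rewrite msetE2 mset_seqE /= eqxx in_mset.
  by move: xA; rewrite in_mset; lia.
apply: (sP _ (B `\ x)%mset); apply/msetP => y; have := EC y.
rewrite !msetE2 !mset_seqE /= msetnE eq_sym.
case: (eqVneq x y) => [<-|_] /=; last by rewrite subn0.
by move: xB; rewrite in_mset; lia.
Qed.

Let bound3 (f g h : fps) K : exists s, conv_bound3 (@msetD I) s f g h K.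
Proof.
have [s sP] := divisors_ex K; exists s => A B C E _ _ _.
split; first by apply: (sP _ (msetD B C)); rewrite msetDA.
  by apply: (sP _ (msetD A C)); rewrite msetDA (msetDC B).
by apply: (sP _ (msetD A B)); rewrite msetDC.
Qed.

Let bound2 (K : monom) :
  exists s, forall f g : fps, conv_bound2 (@msetD I) s f g K.
Proof.
have [s sP] := divisors_ex K; exists s => f g A B E _ _.
by split; [apply: (sP _ B)|apply: (sP _ A); rewrite msetDC].
Qed.

Definition fps_one : fps := conv1 mset0 L.
Definition fps_mul (f g : fps) : fps := conv (@msetD I) f g.

Let mulA : associative fps_mul.
Proof.
move=> f g h; apply/funext => K; have [s bs] := bound3 f g h K.
exact: (convA addmC addmA bs).
Qed.

Let mulC : commutative fps_mul.
Proof. by move=> f g; apply: convC. Qed.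

Let mul1 : left_id fps_one fps_mul.
Proof. by move=> f; apply: conv1l. Qed.

Let mulD : left_distributive fps_mul +%R.
Proof.
move=> f g h; apply/funext => K; have [s bs] := bound2 K.
exact: (@convDl _ _ _ s).
Qed.

Let one_neq0 : fps_one != 0.
Proof.
apply/eqP => /(congr1 (fun f : fps => f mset0)) /eqP.
by rewrite /fps_one /conv1 eqxx oner_eq0.
Qed.

HB.instance Definition _ :=
  GRing.Zmodule_isComNzRing.Build fps mulA mulC mul1 mulD one_neq0.

Let scalAl (k : rat) (f g : fps) : k *: (f * g) = (k *: f) * g.
Proof.
apply/funext => K; have [s bs] := bound2 K.
by rewrite -[RHS]/(conv (@msetD I) (fun A => k *: f A) g K)
  (convZl (scaler0 L k) (scalerDr k) (scalerAl k) (bs f g)).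
Qed.

HB.instance Definition _ := GRing.Lmodule_isLalgebra.Build rat fps scalAl.
HB.instance Definition _ := GRing.Lalgebra_isComAlgebra.Build rat fps.

Definition fpsC (c : L) : fps := fun K => if K == mset0 then c else 0.
Definition fpsX (i : I) : fps := fun K => (K == [mset i]%mset)%:R.
Definition fps_deriv (i : I) (f : fps) : fps :=
  fun K => f (i +` K)%mset *+ (K i).+1.

(* Infinite sum of a locally finite family (each monomial occurs in finitely
   many f j), computed coefficientwise.  A coefficient in which infinitely many
   f j contribute would be 0, but every use below is on a locally finite
   family. *)
Definition fps_sum (J : choiceType) (f : J -> fps) : fps :=
  fun K => \sum_(j \in [set: J]) f j K.

End Fps.

Notation "\fps_sum_ j f" := (fps_sum (fun j => f))
  (at level 41, j name, f at level 41) : ring_scope.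

(* The cohomological data entering the genus-0 theory of a compact symplectic
   manifold V of real dimension 2 * dim: its even cohomology ring and, for each
   number k of marked points and each class A in H_2(V, Z), the even cohomology
   ring of the moduli space of stable maps \bar M_{0,k}(V, A) with its cotangent
   classes, evaluation maps and virtual fundamental class.
   The rings moduli k A are allowed to be trivial (empty moduli space). *)
Record gw_theory (R : realType) := GWTheory {
  coh : falgType rat;
  coh_mulC : commutative (@GRing.mul coh);

  dim : nat;
  coh_deg : nat -> {vspace coh};        (* coh_deg p = H^{2p}(V, Q) *)
  coh_deg_full : (\sum_(p < dim.+1) coh_deg p)%VS = fullv;
  coh_deg_direct : directv (\sum_(p < dim.+1) coh_deg p);
  coh_deg_vanish : forall p, (dim < p)%N -> coh_deg p = 0%VS;
  coh_deg1 : 1 \in coh_deg 0;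
  coh_degM : forall p q x y,
    x \in coh_deg p -> y \in coh_deg q -> x * y \in coh_deg (p + q);

  coh_int : {scalar coh};               (* x |-> \int_V x *)
  coh_int_deg : forall p x, p != dim -> x \in coh_deg p -> coh_int x = 0;
  c1 : coh;
  c1_deg : c1 \in coh_deg 1;

  (* N = nbasis.+1, and the indices 1, ..., N are the elements of 'I_N, the
     insertion 1 being ord0 *)
  nbasis : nat;
  basis : nbasis.+1.-tuple coh;
  basisP : basis_of fullv basis;
  basis_1 : tnth basis ord0 = 1;
  halfdeg : 'I_nbasis.+1 -> nat;
  basis_deg : forall a, tnth basis a \in coh_deg (halfdeg a);
  halfdeg_homo : forall a b : 'I_nbasis.+1,
    (a <= b)%N -> (halfdeg a <= halfdeg b)%N;
  poincare_duality :
    \matrix_(a, b) coh_int (tnth basis a * tnth basis b) \in unitmx;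

  hom2 : zmodType;                      (* H_2(V, Z) *)
  hom2_fg : exists s : seq hom2, forall A, exists c : 'I_(size s) -> int,
    A = \sum_(i < size s) s`_i *~ c i;
  omega : {additive hom2 -> R};         (* A |-> \int_A of the symplectic form *)

  moduli : nat -> hom2 -> comPzRingType;
  psi : forall k A, 'I_k -> moduli k A; (* c_1(E_i) *)
  ev : forall k A, 'I_k -> {rmorphism coh -> moduli k A};
  virt : forall k A, {additive moduli k A -> rat};
  virt_sym : forall k A (s : 'S_k) (n : 'I_k -> nat) (x : 'I_k -> coh),
    virt k A (\prod_i (psi A (s i) ^+ n i * ev A (s i) (x i))) =
    virt k A (\prod_i (psi A i ^+ n i * ev A i (x i)));
  virt_unstable : forall k x, (k < 3)%N -> virt k 0 x = 0;
  virt_compact : forall k (c : R),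
    finite_set [set A | (exists x, virt k A x != 0) /\ omega A <= c] }.

Section Genus0.
Variables (R : realType) (V : gw_theory R).

Local Notation N := (nbasis V).+1.
Local Notation "'O_ a" := (tnth (basis V) a)
  (at level 8, a at level 2, format "''O_' a").
Local Notation Lambda := (novikov (omega V)).

Definition eta : 'M[rat]_N := \matrix_(a, b) coh_int V ('O_a * 'O_b).
Definition eta_inv : 'M[rat]_N := invmx eta.

Definition b_ (a : 'I_N) : rat := (halfdeg a)%:R - ((dim V)%:R - 1) / 2.

(* chernU a b = C_a^b and chernL a b = C_{ab} *)
Definition chernU : 'M[rat]_N := \matrix_(a, b) coord (basis V) b (c1 V * 'O_a).
Definition chernL : 'M[rat]_N := chernU *m eta.

(* (m, a) stands for the variable t^a_m and for the insertion tau_m(O_a) *)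
Local Notation insertion := (nat * 'I_N)%type.

Definition gw_inv (s : seq insertion) (A : hom2 V) : rat :=
  virt (size s) A (\prod_i (psi A i ^+ (tnth (in_tuple s) i).1 *
                            ev A i 'O_((tnth (in_tuple s) i).2))).

Lemma gw_inv_finite s : gw_inv s \in novikov_finite (omega V).
Proof.
apply/novikov_finiteP => c.
apply: (sub_finite_set _ (virt_compact V (size s) c)) => A [nz Ac].
by split=> //; eexists; exact: nz.
Qed.

(* <tau_{n_1}(O_{a_1}) ... tau_{n_k}(O_{a_k})>_0 = \sum_A gw_inv A q^A *)
Definition correlator (s : seq insertion) : Lambda := Novikov (gw_inv_finite s).

Local Notation fps := (fps insertion Lambda).

Definition t_ (m : nat) (a : 'I_N) : fps := fpsX _ (m, a).
Definition tt_ (m : nat) (a : 'I_N) : fps :=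
  t_ m a - ((m == 1%N) && (a == ord0))%:R.

(* <exp \sum t^a_m tau_m(O_a)>_0, the k-th power of the sum being expanded over
   the sequences of length k of insertions *)
Definition F0 : fps := \fps_sum_s
  ((size s)`!%:R^-1 : rat) *:
  (fpsC (correlator s) * \prod_(i <- s) t_ i.1 i.2).

(* Constant coefficient vector fields, acting as derivations: tau_m(O_a) is
   d/dt^a_m, and 0 for m < 0 *)
Definition tau (m : int) (a : 'I_N) : fps -> fps :=
  if m is Posz n then fps_deriv (n, a) else fun=> 0.
Definition Oup (a : 'I_N) : fps -> fps :=
  fun f => \sum_b eta_inv a b *: tau 0 b f.

(* corr [:: D_1; ...; D_k] = <<D_1 ... D_k>>_0 *)
Definition corr (s : seq (fps -> fps)) : fps := foldr (fun D f => D f) F0 s.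

Definition string_equation : Prop :=
  \fps_sum_i (tt_ i.1 i.2 * corr [:: tau (i.1%:Z - 1) i.2]) =
  - (1 / 2 : rat) *: \sum_a \sum_b eta a b *: (t_ 0 a * t_ 0 b).

Definition dilaton_equation : Prop :=
  \fps_sum_i (tt_ i.1 i.2 * corr [:: tau i.1 i.2]) = 2 * F0.

Definition hori_equation : Prop :=
  \fps_sum_i ((i.1%:R + b_ i.2) *: (tt_ i.1 i.2 * corr [:: tau i.1 i.2])) +
  \fps_sum_i (\sum_b chernU i.2 b *:
                (tt_ i.1 i.2 * corr [:: tau (i.1%:Z - 1) b])) =
  - (1 / 2 : rat) *: \sum_a \sum_b chernL a b *: (t_ 0 a * t_ 0 b).

Definition topological_recursion : Prop :=
  forall (m n k : nat) (a b c : 'I_N), (0 < m)%N ->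
  corr [:: tau m a; tau n b; tau k c] =
  \sum_s corr [:: tau (m%:Z - 1) a; tau 0 s] *
         corr [:: Oup s; tau n b; tau k c].

Definition Psi01 : fps :=
  - (\fps_sum_i (tt_ i.1 i.2 * corr [:: tau (i.1%:Z + 1) i.2])) +
  (1 / 2 : rat) *: \sum_a corr [:: tau 0 a] * corr [:: Oup a].

End Genus0.

Arguments F0 {R} V.
Arguments Psi01 {R} V.

(* Main.v *)
Require Import Defs.
From HB Require Import structures.
From mathcomp Require Import all_boot all_order all_algebra.
From mathcomp Require Import finmap multiset.
From mathcomp Require Import all_classical all_reals.
From mathcomp Require Import ring zify.

(** Write D_i for the derivative in the variable indexed by i = (m, a), F for
    the free energy, i+ for (m + 1, a), and (f, g) for the bilinear form
    \sum_(a, b) eta^{ab} D_{0,a} f * D_{0,b} g ([metric_pairing]).  Every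
    equation involved is an equation between power series in characteristic 0,
    so it holds as soon as it holds after every D_k and at the origin
    ([fps_deriv_eq0]).

    The heart of the proof is the two-point identity
      (D_i F, D_j F) = D_{i+} D_j F + D_i D_{j+} F    ([metric_pairing_deriv]).
    By topological recursion, each derivative of the difference of its two
    sides is 0 ([deriv_swap_defect]), so the difference is a constant.  That
    constant is evaluated through a derivative which is already known to vanish,
    the one in the direction of the unit (0, ord0): at the origin, the string
    equation turns an insertion of the unit into lowered indices
    ([ev_string]), and the vanishing becomes a relation between the constants
    for lower descendant levels.  This relation gives 0 when j is a primary
    insertion, and otherwise lets one move a level from j to i, up to sign
    ([swap_defect_primary], [swap_defect_shift]).

    The constraint follows by differentiating it twice.  In D_k D_j Psi, the
    terms in which both derivatives hit distinct factors are the two-point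
    identity, and the infinite sum that remains is, by topological recursion,
    (\sum_i ~t_i D_i F, D_k D_j F), which the differentiated dilaton equation
    \sum_i ~t_i D_i D_j F = D_j F ([euler_deriv_dilaton]) identifies with
    (F, D_k D_j F).  Hence the second derivatives of Psi vanish.  At the
    origin, ~t is concentrated at the insertion (1, ord0), where the dilaton
    equation says D_{(1, ord0)} D_j F = - D_j F; with it, the two-point identity
    for i = (1, ord0) is exactly the vanishing of D_j Psi at the origin, and
    for i = j = (1, ord0) that of Psi itself.

    The argument never looks inside a power series, so it is carried out in an
    arbitrary algebra with commuting derivations, an evaluation at the origin
    and an operator that behaves as the infinite sums do. *)

Set Implicit Arguments.
Unset Strict Implicit.
Unset Printing Implicit Defensive.

Import GRing.Theory.
Local Open Scope classical_set_scope.
Local Open Scope ring_scope.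

(** * Differential calculus of formal power series *)

Lemma derivation_nat (A : comAlgType rat) (d : {linear A -> A}) n :
  (forall f g, d (f * g) = d f * g + f * d g) -> d n%:R = 0.
Proof.
move=> derivM; have d1 : d 1 = 0.
  by have := derivM 1 1; rewrite !mulr1 mul1r -[LHS]addr0 => /addrI/esym.
by rewrite linearMn /= d1 mul0rn.
Qed.

Section PowerSeries.
Variables (I : choiceType) (L : comAlgType rat).
Local Notation fps := (fps I L).
Local Notation monom := {mset I}%mset.
Implicit Types (f g h : fps) (K A B : monom) (i j : I)
  (u : I -> fps).

Lemma mulrnSI (M : lmodType rat) n : injective (fun x : M => x *+ n.+1).
Proof.
move=> x y /eqP; rewrite -subr_eq0 -mulrnBl -scaler_nat scaler_eq0.
by rewrite Num.Theory.pnatr_eq0 /= subr_eq0 => /eqP.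
Qed.

(** Sums over the factorizations of a monomial have to be split in two, which
    is legitimate for the support-based sums only over a finite index set. *)
Lemma finite_divisors K : finite_set [set p : monom * monom | msetD p.1 p.2 = K].
Proof.
have fin s : finite_set [set A : monom | (A `<=` seq_mset s)%mset].
  elim: s => [|x s IHs].
    apply: (@sub_finite_set _ _ [set mset0]) => [A /msubsetP As|];
      last exact: finite_set1.
    by apply/msetP => y; have := As y; rewrite mset_seqE mset0E leqn0 => /eqP.
  apply: (@sub_finite_set _ _ ([set A : monom | (A `<=` seq_mset s)%mset] `|`
      (fun A => x +` A)%mset @` [set A : monom | (A `<=` seq_mset s)%mset])).
    move=> A /msubsetP As; have [xA|xA] := boolP (x \in A); [right|left].
      exists (A `\ x)%mset; last exact: msetB1K.
      apply/msubsetP => y; have := As y.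
      by rewrite msetB1E !mset_seqE /= eq_sym; lia.
    apply/msubsetP => y; have := As y; rewrite !mset_seqE /=.
    by case: eqVneq xA => [<- |_ _]; rewrite ?add0n // -mset_eq0 => /eqP ->.
  by rewrite finite_setU; split=> //; apply: finite_image.
have finK : finite_set [set A : monom | (A `<=` K)%mset].
  by rewrite -(seq_mset_id K).
apply: (sub_finite_set _ (finite_setX finK finK)) => -[A B] /= <-.
by split; apply/msubsetP => y; rewrite msetE2 ?leq_addr ?leq_addl.
Qed.

Lemma fps_mulE f g K :
  (f * g) K =
  \sum_(p \in [set p : monom * monom | msetD p.1 p.2 = K]) f p.1 * g p.2.
Proof. by []. Qed.

Lemma fps_bigE (J : finType) (v : J -> fps) K :
  (\sum_t v t) K = \sum_t v t K.
Proof. exact: (big_morph (fun f : fps => f K)). Qed.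

Lemma fps_deriv_is_linear i : linear (@fps_deriv I L i).
Proof.
move=> a f g; apply/funext => K; rewrite /fps_deriv.
by rewrite -[LHS]/((a *: f (i +` K)%mset + g (i +` K)%mset) *+ _) mulrnDl scalerMnr.
Qed.

HB.instance Definition _ i := GRing.isLinear.Build rat fps fps _
  (@fps_deriv I L i) (fps_deriv_is_linear i).

(** The Euler operator t_i d/dt_i. It is used to prove the Leibniz rule because
    it multiplies each coefficient by an exponent, which is additive in the
    monomial, whereas differentiation also shifts the coefficients. *)
Definition weight i f : fps := fun K => f K *+ K i.

Lemma weightM i f g : weight i (f * g) = weight i f * g + f * weight i g.
Proof.
apply/funext => K; rewrite -[RHS]/((weight i f * g) K + (f * weight i g) K).
rewrite {1}/weight !fps_mulE -fsbig_split /=; last exact: finite_divisors.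
rewrite !fsbig_finite; try exact: finite_divisors.
rewrite -sumrMnl big_seq [RHS]big_seq; apply: eq_bigr => -[A B].
rewrite in_fset_set; last exact: finite_divisors.
rewrite inE /= => <-; rewrite /weight msetE2 mulrnDr mulrnAl.
by rewrite mulrnAr.
Qed.

Lemma fps_derivE i f K : fps_deriv i f K = weight i f (i +` K)%mset.
Proof. by rewrite /weight mset1DE eqxx add1n. Qed.

(** Both sides are the coefficient of K in the product of d f/dt_i and g: the
    factors A of i K in which t_i does not occur have weight 0, and the others
    are exactly the i A' with A' a factor of K. *)
Lemma weight_mul_shift i f g K :
  (weight i f * g) (i +` K)%mset = (fps_deriv i f * g) K.
Proof.
rewrite !fps_mulE.
pose h (p : monom * monom) : monom * monom := ((i +` p.1)%mset, p.2).
rewrite -(@fsbig_widen _ _ _ _ (h @` [set p | msetD p.1 p.2 = K])) /=.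
- rewrite fsbig_image.
    by apply: eq_fsbigr => p _; rewrite /= fps_derivE.
  move=> [A B] [C D] _ _ /= [/(congr1 (fun C : monom => C `\ i)%mset)].
  by rewrite !msetD1K => -> ->.
- by move=> _ [[A B] /= <- <-]; rewrite /= msetDA.
- move=> [A B] /= [AB nAB]; rewrite /weight.
  have [iA|] := boolP (i \in (A : monom)); last by move/mset_eq0P ->; rewrite mul0r.
  case: nAB; exists ((A `\ i)%mset, B); last by rewrite /h /= msetB1K.
  rewrite /=; have := congr1 (fun C => C `\ i)%mset AB; rewrite msetD1K => <-.
  by rewrite -{2}(msetB1K iA) -msetDA msetD1K.
Qed.

Lemma fps_derivM i f g :
  fps_deriv i (f * g) = fps_deriv i f * g + f * fps_deriv i g.
Proof.
apply/funext => K; rewrite fps_derivE weightM.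
rewrite -[LHS]/((weight i f * g) _ + (f * weight i g) _).
by rewrite [f * weight i g]mulrC !weight_mul_shift [fps_deriv i g * f]mulrC.
Qed.

Lemma fps_deriv_comm i j f :
  fps_deriv i (fps_deriv j f) = fps_deriv j (fps_deriv i f).
Proof.
apply/funext => K; rewrite /fps_deriv msetDCA -!mulrnA !mset1DE [i == j]eq_sym.
by case: eqVneq => [->//|_]; rewrite mulnC.
Qed.

(** Characteristic 0 is used here: a coefficient other than the constant one is
    recovered from a derivative by division by an exponent. *)
Lemma fps_deriv_eq0 f :
  (forall i, fps_deriv i f = 0) -> f mset0 = 0 -> f = 0.
Proof.
move=> df0 f0; apply/funext => K; have [->//|/eqP nK] := eqVneq K mset0.
have [i iK] : exists i, i \in K.
  apply: contrapT => noK; apply: nK; apply/msetP => i; rewrite mset0E.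
  by apply/mset_eq0P/negP => iK; apply: noK; exists i.
rewrite -(msetB1K iK); apply: (@mulrnSI L ((K `\ i)%mset i)); rewrite mul0rn.
exact: (congr1 (fun g : fps => g (K `\ i)%mset) (df0 i)).
Qed.

Definition const_coef f : L := f mset0.

Lemma const_coefM f g : const_coef (f * g) = const_coef f * const_coef g.
Proof.
rewrite /const_coef fps_mulE (_ : [set p | _] = [set (mset0, mset0)]) ?fsbig_set1 //.
apply/seteqP; split=> [[A B] /= AB|_ -> /=]; last by rewrite mset0D.
by congr (_, _); apply/msetP => y;
  have := congr1 (fun C : monom => C y) AB; rewrite msetE2 mset0E; lia.
Qed.

Lemma const_coef1 : const_coef 1 = 1.
Proof. by rewrite /const_coef -[LHS]/((mset0 == mset0 :> monom)%:R) eqxx. Qed.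

HB.instance Definition _ := GRing.isLinear.Build rat fps L _ const_coef
  (fun _ _ _ => erefl).
HB.instance Definition _ := GRing.isMonoidMorphism.Build fps L const_coef
  (conj const_coef1 const_coefM).

Lemma const_coefX i : const_coef (fpsX L i) = 0.
Proof.
rewrite /const_coef /fpsX; case: eqVneq => // /(congr1 (fun C : monom => C i)).
by rewrite mset0E msetnxx.
Qed.

Lemma fps_derivX i j : fps_deriv i (fpsX L j) = (i == j)%:R.
Proof.
apply/funext => K; rewrite /fps_deriv /fpsX.
have -> : (i +` K == [mset j])%mset = (i == j) && (K == mset0).
  apply/eqP/andP => [iK|[/eqP -> /eqP ->]]; last by rewrite msetD0.
  have ij : i == j.
    by have := mset1D1 i K; rewrite iK in_mset1.
  split=> //; apply/eqP; have := congr1 (fun C => C `\ i)%mset iK.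
  by rewrite msetD1K (eqP ij) -[X in (X `\ _)%mset]msetD0 msetD1K.
case: eqVneq => [_|]; last by rewrite mul0rn.
case: eqVneq => [->|K0] /=; first by rewrite mset0E -[RHS]/(const_coef 1) const_coef1.
by rewrite mul0rn -[RHS]/((K == mset0)%:R) (negbTE K0).
Qed.

(** The dilaton-shifted Euler operator \sum_i (t_i - delta_(i, i1)) u_i on the
    components of an arbitrary vector field u. *)
Definition shifted_sum i1 (u : I -> fps) : fps :=
  \fps_sum_i ((fpsX L i - (i == i1)%:R) * u i).

Lemma fpsX_mul_eq0 i f K : i \notin K -> (fpsX L i * f) K = 0.
Proof.
move=> iK; apply/eqP; apply: contraNT iK => /conv_neq0[A [B [<- + _]]].
rewrite /fpsX; case: (eqVneq A [mset i]%mset) => [-> _|]; last by rewrite eqxx.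
by rewrite mset1D1.
Qed.

(** Only the variables dividing K, and the shifted one, contribute to the
    coefficient of K; freedom in the choice of s lets several coefficients be
    computed by the same finite sum. *)
Lemma shifted_sumE (s : {fset I}) i1 u K : {subset K <= s} -> i1 \in s ->
  shifted_sum i1 u K = (\sum_(i <- s) (fpsX L i - (i == i1)%:R) * u i) K.
Proof.
move=> Ks i1s; rewrite fct_sumE; apply: fsbigTE => i ins.
rewrite (_ : i == i1 = false) ?subr0.
  by rewrite fpsX_mul_eq0 //; apply: contra ins; apply: Ks.
by apply: contraNF ins => /eqP ->.
Qed.

Lemma deriv_shifted_sum i1 u j : fps_deriv j (shifted_sum i1 u) =
  u j + shifted_sum i1 (fun i => fps_deriv j (u i)).
Proof.
apply/funext => K; pose s : {fset I} := (finsupp (j +` K)%mset `|` [fset j; i1])%fset.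
have sub : {subset (j +` K)%mset <= s}.
  by move=> i; rewrite -msuppE !inE => ->.
have i1s : i1 \in s by rewrite !inE eqxx !orbT.
have js : j \in s by rewrite !inE eqxx !orbT.
rewrite -[RHS]/(u j K + _ K) (@shifted_sumE s) //; last first.
  by move=> i iK; apply: sub; rewrite in_mset1D iK orbT.
rewrite {1}/fps_deriv (@shifted_sumE s) // -[LHS]/(fps_deriv j _ K).
rewrite linear_sum /= -[RHS]/((u j + _) K); congr (_ K).
have deriv_nat m := derivation_nat (d := @fps_deriv I L j) m (fps_derivM j).
under eq_bigr do rewrite fps_derivM linearB /= deriv_nat subr0 fps_derivX.
rewrite big_split /= (bigD1_seq j) //= eqxx mul1r big1 ?addr0 // => i /negbTE.
by rewrite eq_sym => ->; rewrite mul0r.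
Qed.

(** At the origin all t_i vanish, so that only the shift is left. *)
Lemma const_coef_shifted_sum i1 u : const_coef (shifted_sum i1 u) = - const_coef (u i1).
Proof.
transitivity (const_coef ((fpsX L i1 - 1) * u i1)).
  rewrite /const_coef (@shifted_sumE [fset i1]%fset) ?inE //; last first.
    by move=> i; rewrite in_mset0.
  by rewrite big_seq_fset1 eqxx.
have -> : const_coef ((fpsX L i1 - 1) * u i1) = (0 - 1) * const_coef (u i1).
  rewrite const_coefM; congr (_ * _).
  by congr (_ - _); [exact: const_coefX | exact: const_coef1].
by rewrite sub0r mulN1r.
Qed.

(** The coefficient of K in a product involves only coefficients at divisors of
    K, and one finite set of variables serves for all of these. *)
Lemma shifted_sumMr i1 u f :
  shifted_sum i1 (fun i => u i * f) = shifted_sum i1 u * f.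
Proof.
apply/funext => K; pose s : {fset I} := (finsupp K `|` [fset i1])%fset.
have i1s : i1 \in s by rewrite !inE eqxx !orbT.
have sub A B : msetD A B = K -> {subset A <= s}.
  by move=> AB i iA; rewrite !inE msuppE -AB in_msetD iA.
rewrite (@shifted_sumE s) //; last by apply: (sub K mset0); rewrite msetD0.
under eq_bigr do rewrite mulrA.
rewrite -mulr_suml !fps_mulE; apply: eq_fsbigr => -[A B]; rewrite inE /= => AB.
by rewrite (@shifted_sumE s) //; apply: sub AB.
Qed.

Lemma shifted_sum_sum i1 (J : finType) (g : J -> I -> fps) :
  shifted_sum i1 (fun i => \sum_s g s i) = \sum_s shifted_sum i1 (g s).
Proof.
apply/funext => K; pose s : {fset I} := (finsupp K `|` [fset i1])%fset.
have i1s : i1 \in s by rewrite !inE eqxx !orbT.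
have sub : {subset K <= s} by move=> i iK; rewrite !inE msuppE iK.
transitivity ((\sum_t \sum_(i <- s) (fpsX L i - (i == i1)%:R) * g t i) K).
  rewrite (@shifted_sumE s) //; congr (_ K); rewrite exchange_big /=.
  by apply: eq_bigr => i _; rewrite mulr_sumr.
by rewrite !fps_bigE; apply: eq_bigr => t _; rewrite (@shifted_sumE s).
Qed.

End PowerSeries.

(** * The genus-0 recursion *)

Section Descendants.
Variables (n : nat) (A L : comAlgType rat) (metric : 'M[rat]_n.+1).
Hypothesis metric_sym : metric^T = metric.
Hypothesis metric_unit : metric \in unitmx.

Local Notation insertion := (nat * 'I_n.+1)%type.

Definition unit_primary : insertion := (0%N, ord0).
Definition dilaton_index : insertion := (1%N, ord0).

(** [A] plays the power series, [D i] the derivative in the variable [X i],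
    [ev] the evaluation at the origin, and [euler u] the infinite sum of the
    (X i - delta_(i, dilaton_index)) * u i. *)
Variables (D : insertion -> {linear A -> A}) (ev : {lrmorphism A -> L}).
Variables (X : insertion -> A) (euler : (insertion -> A) -> A).
Hypothesis derivM : forall i f g, D i (f * g) = D i f * g + f * D i g.
Hypothesis deriv_comm : forall i j f, D i (D j f) = D j (D i f).
Hypothesis derivX : forall i j, D i (X j) = (i == j)%:R.
Hypothesis deriv_eq0 : forall f, (forall i, D i f = 0) -> ev f = 0 -> f = 0.
Hypothesis euler_deriv : forall u j, D j (euler u) = u j + euler (fun i => D j (u i)).
Hypothesis ev_euler : forall u, ev (euler u) = - ev (u dilaton_index).
Hypothesis euler_sum : forall (J : finType) (v : J -> insertion -> A),
  euler (fun i => \sum_t v t i) = \sum_t euler (v t).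
Hypothesis eulerMr : forall u f, euler (fun i => u i * f) = euler u * f.

Implicit Types (i j k l : insertion) (f g h : A) (a b c : 'I_n.+1).

(** The bilinear form \sum_a <<O_a f>> <<O^a g>> of the recursion relation. *)
Definition metric_pairing f g : A :=
  \sum_a D (0%N, a) f * \sum_b invmx metric a b *: D (0%N, b) g.

Lemma metric_pairingC f g : metric_pairing f g = metric_pairing g f.
Proof.
rewrite /metric_pairing; under eq_bigr do rewrite mulr_sumr.
under [RHS]eq_bigr do rewrite mulr_sumr.
rewrite exchange_big; apply: eq_bigr => b _; apply: eq_bigr => a _.
rewrite -!scalerAr mulrC; congr (_ *: _).
by rewrite -[in LHS]metric_sym -trmx_inv mxE.
Qed.

Lemma deriv_metric_pairing i f g :
  D i (metric_pairing f g) = metric_pairing (D i f) g + metric_pairing f (D i g).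
Proof.
rewrite /metric_pairing linear_sum -big_split; apply: eq_bigr => a _ /=.
rewrite derivM deriv_comm linear_sum; congr (_ + _ * _).
by apply: eq_bigr => b _; rewrite linearZ /= deriv_comm.
Qed.

Lemma ev_metric_pairing f g : ev (metric_pairing f g) =
  \sum_a ev (D (0%N, a) f) * \sum_b invmx metric a b *: ev (D (0%N, b) g).
Proof.
rewrite /metric_pairing linear_sum; apply: eq_bigr => a _.
rewrite rmorphM /= [ev (\sum_b _)]linear_sum; congr (_ * _).
by apply: eq_bigr => b _; rewrite linearZ.
Qed.

Definition raise i : insertion := (i.1.+1, i.2).
(** The insertion tau_(m-1), which is 0 when m = 0. *)
Definition lower i f : A := if i.1 is m.+1 then D (m, i.2) f else 0.

Lemma lower_raise i f : lower (raise i) f = D i f.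
Proof. by case: i. Qed.

Variable F : A.
Hypothesis string : euler (fun i => lower i F) =
  - (1 / 2 : rat) *: \sum_a \sum_b metric a b *:
       (X (0%N, a) * X (0%N, b)).
Hypothesis dilaton : euler (fun i => D i F) = 2 * F.
Hypothesis trr : forall i j k,
  D (raise i) (D j (D k F)) = metric_pairing (D i F) (D j (D k F)).

Lemma euler_deriv_dilaton j : euler (fun i => D j (D i F)) = D j F.
Proof.
apply: (addrI (D j F)); rewrite -euler_deriv dilaton.
by rewrite mulrDl mul1r linearD.
Qed.

Lemma ev_dilaton j : ev (D j (D dilaton_index F)) = - ev (D j F).
Proof. by rewrite -[in RHS]euler_deriv_dilaton ev_euler opprK. Qed.

Definition primary_metric i j : L :=
  if (i.1 == 0%N) && (j.1 == 0%N) then (metric i.2 j.2)%:A else 0.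

Lemma ev_deriv2_quadratic i j :
  ev (D i (D j (\sum_a \sum_b metric a b *:
       (X (0%N, a) * X (0%N, b))))) = 2%:R *: primary_metric i j.
Proof.
have DD a b : D i (D j (X (0%N, a) * X (0%N, b))) =
   (i == (0%N, a))%:R * (j == (0%N, b))%:R +
   (j == (0%N, a))%:R * (i == (0%N, b))%:R.
  rewrite derivM linearD /= !derivM !derivX !(derivation_nat _ (derivM i)).
  by rewrite mul0r mulr0 add0r addr0 addrC.
rewrite linear_sum linear_sum /=.
have -> : \sum_a D i (D j (\sum_b metric a b *: (X (0%N, a) * X (0%N, b))))
  = \sum_a \sum_b metric a b *: ((i == (0%N, a))%:R * (j == (0%N, b))%:R)
  + \sum_a \sum_b metric a b *: ((j == (0%N, a))%:R * (i == (0%N, b))%:R).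
  rewrite -big_split /=; apply: eq_bigr => a _.
  rewrite linear_sum linear_sum -big_split /=; apply: eq_bigr => b _.
  by rewrite linearZ linearZ /= DD scalerDr.
(* Only a = k.2, b = l.2 contribute, and only if k and l are primary. *)
have S k l : \sum_a \sum_b metric a b *: ((k == (0%N, a))%:R * (l == (0%N, b))%:R)
   = (if (k.1 == 0%N) && (l.1 == 0%N) then (metric k.2 l.2)%:A else 0) :> A.
  case: k l => [m c] [p d] /=.
  rewrite (bigD1 c) //= [X in _ + X]big1 ?addr0; last first.
    move=> a /negbTE ac; rewrite big1 // => b _.
    by rewrite xpair_eqE [c == a]eq_sym ac andbF mul0r scaler0.
  rewrite (bigD1 d) //= [X in _ + X]big1 ?addr0; last first.
    move=> b /negbTE bd.
    by rewrite !xpair_eqE [d == b]eq_sym bd andbF mulr0 scaler0.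
  rewrite !xpair_eqE !eqxx !andbT.
  by case: (m == _); case: (p == _); rewrite ?mul1r ?mul0r ?scaler0.
have C (q : rat) : ev (q%:A : A) = q%:A.
  by rewrite linearZ /= rmorph1.
rewrite !S /primary_metric [(j.1 == _) && _]andbC.
case: ifP => _; last by rewrite addr0 linear0 scaler0.
rewrite scaler_nat mulr2n linearD /= !C.
by rewrite -[in X in _ + X]metric_sym mxE.
Qed.

(** The second derivative of the string equation at the origin: the infinite
    sum reduces to minus its term at the dilaton index, whose lowering is the
    unit, and the two other terms come from differentiating the coefficients. *)
Lemma ev_string i j : ev (D unit_primary (D i (D j F))) =
  ev (D i (lower j F)) + ev (D j (lower i F)) + primary_metric i j.
Proof.
move: string (ev_deriv2_quadratic i j); set Q := \sum_a _ => stringQ constQ.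
have := congr1 (fun f => ev (D i (D j f))) stringQ.
rewrite !euler_deriv linearD /= euler_deriv.
rewrite [in RHS]linearZ [in RHS]linearZ /= linearZ /= constQ.
rewrite 2!linearD /= ev_euler scalerA mulNr divfK // scaleN1r.
rewrite -[lower dilaton_index F]/(D unit_primary F).
rewrite (deriv_comm unit_primary i) (deriv_comm unit_primary j).
by move/eqP; rewrite addrA subr_eq => /eqP ->; rewrite addrAC addNr add0r.
Qed.

Definition swap_defect i j : A :=
  metric_pairing (D i F) (D j F) - D (raise i) (D j F) - D i (D (raise j) F).

(** Topological recursion rewrites each of the last two terms of the defect,
    once differentiated, as one of the two Leibniz terms of the pairing. *)
Lemma deriv_swap_defect k i j : D k (swap_defect i j) = 0.
Proof.
rewrite /swap_defect 2!linearB /= deriv_metric_pairing.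
have -> : D k (D (raise i) (D j F)) = metric_pairing (D i F) (D k (D j F)).
  exact: etrans (deriv_comm k (raise i) (D j F)) (trr i k j).
have -> : D k (D i (D (raise j) F)) = metric_pairing (D j F) (D k (D i F)).
  apply: etrans (congr1 (D k) (deriv_comm i (raise j) F)) _.
  exact: etrans (deriv_comm k (raise j) (D i F)) (trr j k i).
by rewrite addrK metric_pairingC subrr.
Qed.

(** Lowering the primary insertions in the pairing gives 0, so the string
    equation only lowers i; the metric in it cancels the inverse metric of the
    pairing, which gives the extra term. *)
Lemma ev_metric_pairing_string i f : ev (metric_pairing (D unit_primary (D i F)) f) =
  ev (metric_pairing (lower i F) f) +
  (if i.1 == 0%N then ev (D (0%N, i.2) f) else 0).
Proof.
rewrite !ev_metric_pairing.
have stringE a : ev (D (0%N, a) (D unit_primary (D i F))) =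
    ev (D (0%N, a) (lower i F)) + primary_metric i (0%N, a).
  rewrite deriv_comm (deriv_comm _ i) ev_string [lower (0%N, a) F]/lower /=.
  by rewrite !linear0 add0r.
under eq_bigr do rewrite stringE mulrDl.
rewrite big_split /=; congr (_ + _); rewrite /primary_metric /= andbT.
case: eqVneq => _; last by rewrite big1 // => a _; rewrite mul0r.
under eq_bigr do rewrite mulr_sumr.
rewrite exchange_big /=.
transitivity (\sum_b (metric *m invmx metric) i.2 b *: ev (D (0%N, b) f)).
  apply: eq_bigr => b _; rewrite mxE scaler_suml; apply: eq_bigr => a _.
  by rewrite mulr_algl scalerA.
rewrite mulmxV // (bigD1 i.2) //= mxE eqxx scale1r big1 ?addr0 // => b.
by rewrite mxE eq_sym => /negbTE ->; rewrite scale0r.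
Qed.

Lemma ev_string_raise i j : ev (D unit_primary (D (raise i) (D j F))) =
  ev (D (raise i) (lower j F)) + ev (D i (D j F)).
Proof.
rewrite ev_string lower_raise (_ : primary_metric (raise i) j = 0) // addr0.
by congr (_ + ev _); exact: deriv_comm.
Qed.

(** The relation between constants obtained by expanding, by the string
    equation, the vanishing derivative of the defect along the unit. *)
Lemma swap_defect_string i j :
  ev (metric_pairing (lower i F) (D j F)) + ev (metric_pairing (lower j F) (D i F)) +
  (if i.1 == 0%N then ev (D i (D j F)) else 0) +
  (if j.1 == 0%N then ev (D i (D j F)) else 0) =
  ev (D i (D j F)) + ev (D i (D j F)) + ev (D (raise i) (lower j F))
  + ev (D (raise j) (lower i F)).
Proof.
have := congr1 ev (deriv_swap_defect unit_primary i j).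
rewrite /swap_defect !linearB /= deriv_metric_pairing linearD /= linear0.
rewrite (metric_pairingC (D i F)) !ev_metric_pairing_string.
rewrite (deriv_comm i (raise j) F) !ev_string_raise.
have pri k f : (if k.1 == 0%N then ev (D (0%N, k.2) f) else 0) =
               (if k.1 == 0%N then ev (D k f) else 0).
  by case: k => [[|m] c].
rewrite !pri (deriv_comm j i F).
set t1 := ev (metric_pairing _ _); set t2 := ev (metric_pairing _ _).
set t3 := ev _; set t4 := ev _; set t5 := ev _.
set t6 := (if i.1 == _ then _ else _); set t7 := (if j.1 == _ then _ else _).
move: t1 t2 t3 t4 t5 t6 t7 => t1 t2 t3 t4 t5 t6 t7 H.
apply/eqP; rewrite -subr_eq0 -H; apply/eqP; ring.
Qed.

Lemma swap_defect_primary i b : ev (swap_defect i (0%N, b)) = 0.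
Proof.
have := swap_defect_string (raise i) (0%N, b).
rewrite /swap_defect !linearB /= !lower_raise metric_pairingC.
rewrite [metric_pairing 0 _]big1 => [|a _]; last by rewrite linear0 mul0r.
rewrite !linear0 !addr0 (deriv_comm i) (metric_pairingC _ (D i F)).
set t1 := ev (metric_pairing _ _); set t2 := ev _; set t3 := ev _.
by rewrite [t1 + t2]addrC -addrA => /addrI ->; rewrite addrAC addrK subrr.
Qed.

Lemma swap_defect_shift i j :
  ev (swap_defect i (raise j)) = - ev (swap_defect (raise i) j).
Proof.
have := swap_defect_string (raise i) (raise j).
rewrite /swap_defect !linearB /= !lower_raise !addr0.
rewrite (deriv_comm i) (metric_pairingC _ (D (raise i) F)).
set t1 := ev (metric_pairing _ _); set t2 := ev (metric_pairing _ _).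
set t3 := ev _; set t4 := ev _; set t5 := ev _.
move: t1 t2 t3 t4 t5 => t1 t2 t3 t4 t5 H.
apply/eqP; rewrite -subr_eq0; apply/eqP.
(* The sum of the two defects is the difference of the two sides of H. *)
transitivity (t1 + t2 - (t3 + t3 + t4 + t5)); first by ring.
by rewrite H subrr.
Qed.

(** Being constant, the defect is determined at the origin, where an induction
    on the descendant level of the second insertion applies. *)
Lemma swap_defect_eq0 i j : swap_defect i j = 0.
Proof.
apply: deriv_eq0 => [k|]; first exact: deriv_swap_defect.
case: j => k b; elim: k i => [|k IHk] i; first exact: swap_defect_primary.
by rewrite (swap_defect_shift i (k, b)) IHk oppr0.
Qed.

Lemma metric_pairing_deriv i j :
  metric_pairing (D i F) (D j F) = D (raise i) (D j F) + D i (D (raise j) F).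
Proof.
by apply/eqP; rewrite -subr_eq0 opprD addrA -/(swap_defect i j) swap_defect_eq0.
Qed.

Definition L1_constraint : A :=
  - euler (fun i => D (raise i) F) + (1 / 2 : rat) *: metric_pairing F F.

Lemma deriv_L1_constraint j : D j L1_constraint =
  - (D (raise j) F + euler (fun i => D j (D (raise i) F))) + metric_pairing F (D j F).
Proof.
rewrite linearD /= linearN linearZ /= euler_deriv deriv_metric_pairing.
rewrite (metric_pairingC (D j F)).
congr (_ + _); rewrite -mulr2n -scaler_nat scalerA.
by rewrite (_ : 1 / 2 * 2%:R = 1 :> rat) // scale1r.
Qed.

(** The infinite sum passes through the pairing to its first argument, where
    the differentiated dilaton equation evaluates it. *)
Lemma euler_metric_pairing f : euler (fun i => metric_pairing (D i F) f) = metric_pairing F f.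
Proof.
rewrite /metric_pairing euler_sum; apply: eq_bigr => a _.
by rewrite eulerMr euler_deriv_dilaton.
Qed.

(** The two-point identity cancels the terms outside the infinite sum against
    the pairing of first derivatives; recursion and dilaton equation turn the
    sum into the remaining pairing. *)
Lemma deriv2_L1_constraint k j : D k (D j L1_constraint) = 0.
Proof.
rewrite deriv_L1_constraint linearD /= linearN linearD /= euler_deriv.
rewrite deriv_metric_pairing metric_pairing_deriv.
have -> : euler (fun i => D k (D j (D (raise i) F))) = metric_pairing F (D k (D j F)).
  rewrite -euler_metric_pairing; congr euler; apply/funext => i.
  by rewrite -trr (deriv_comm j) (deriv_comm k).
by rewrite (deriv_comm (raise k) j) [D j (D (raise k) F) + D k _]addrC -addrA addNr.
Qed.

Lemma ev_metric_pairing_dilaton f :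
  ev (metric_pairing (D dilaton_index F) f) = - ev (metric_pairing F f).
Proof.
by rewrite -[in RHS]euler_metric_pairing ev_euler opprK.
Qed.

(** The two-point identity with first index the dilaton one, in which the
    dilaton equation at the origin removes each insertion of that index. *)
Lemma ev_L1_constraint_deriv j : ev (D j L1_constraint) = 0.
Proof.
have := congr1 ev (metric_pairing_deriv dilaton_index j).
rewrite ev_metric_pairing_dilaton linearD /= (deriv_comm _ (raise j)) ev_dilaton.
rewrite deriv_L1_constraint linearD /= linearN linearD /= ev_euler.
rewrite (deriv_comm j) => H; rewrite -[ev (metric_pairing F _)]opprK H.
by rewrite !opprB addrA subrK subrr.
Qed.

(** As for the first derivatives, with both indices the dilaton one; the
    identity then counts the same two-point value twice, which matches the
    factor 1 / 2 in the constraint. *)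
Lemma ev_L1_constraint : ev L1_constraint = 0.
Proof.
have := congr1 ev (metric_pairing_deriv dilaton_index dilaton_index).
rewrite ev_metric_pairing_dilaton metric_pairingC ev_metric_pairing_dilaton opprK.
rewrite linearD /= (deriv_comm _ (raise _)) ev_dilaton => H.
rewrite /L1_constraint linearD /= linearN linearZ /= ev_euler H opprK.
rewrite -opprD -mulr2n -scaler_nat scalerN scalerA mul1r mulVf // scale1r.
by rewrite subrr.
Qed.

Lemma L1_constraint_eq0 : L1_constraint = 0.
Proof.
apply: deriv_eq0 => [j|]; last exact: ev_L1_constraint.
apply: deriv_eq0 => [k|]; first exact: deriv2_L1_constraint.
exact: ev_L1_constraint_deriv.
Qed.

End Descendants.

(** * Gromov-Witten theory *)

Section GromovWitten.
Variables (R : realType) (V : gw_theory R).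
Local Notation insertion := (nat * 'I_(nbasis V).+1)%type.
Local Notation Lambda := (novikov (omega V)).
Local Notation A := (fps insertion Lambda).

Definition tau_deriv (i : insertion) : {linear A -> A} := @fps_deriv insertion Lambda i.

Lemma tau_pred (i : insertion) (f : A) : tau (i.1%:Z - 1) i.2 f = lower tau_deriv i f.
Proof.
case: i => [[|m] a] //.
by rewrite (_ : m.+1%:Z - 1 = m) // -addn1 PoszD addrK.
Qed.

Lemma tau_succ (i : insertion) (f : A) : tau (i.1%:Z + 1) i.2 f = tau_deriv (raise i) f.
Proof. by rewrite -PoszD addn1. Qed.

Lemma tau_nat (i : insertion) (f : A) : tau i.1 i.2 f = tau_deriv i f.
Proof. by case: i. Qed.

Lemma eta_sym : (Defs.eta V)^T = Defs.eta V.
Proof. by apply/matrixP => a b; rewrite !mxE coh_mulC. Qed.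

Lemma fps_sum_tt (u : insertion -> A) :
  \fps_sum_i (@tt_ R V i.1 i.2 * u i) = shifted_sum (dilaton_index _) u.
Proof.
have tt m a : @tt_ R V m a = @fpsX insertion Lambda (m, a) - ((m, a) == dilaton_index _)%:R.
  by rewrite /tt_ /t_ xpair_eqE.
rewrite /shifted_sum; apply: (congr1 (@fps_sum _ _ _)); apply/funext => i.
by apply: (congr1 (fun f => f * u i)); rewrite tt -surjective_pairing.
Qed.

Lemma metric_pairing_Oup (f g : A) :
  \sum_a tau 0 a f * Oup a g = metric_pairing (Defs.eta V) tau_deriv f g.
Proof. by []. Qed.

(** A constant shift k of the descendant level covers the sums of the string
    equation (k = -1) and of the constraint (k = 1) at once. *)
Lemma shifted_sum_tau (k : int) (u : insertion -> A) :
  (forall i, tau (i.1%:Z + k) i.2 (F0 V) = u i) ->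
  \fps_sum_i (@tt_ R V i.1 i.2 * corr [:: tau (i.1%:Z + k) i.2]) =
  shifted_sum (dilaton_index _) u.
Proof.
move=> tau_u; apply: etrans (fps_sum_tt (fun i => tau (i.1%:Z + k) i.2 (F0 V))) _.
by apply: congr1; apply/funext.
Qed.

End GromovWitten.

Theorem proposition5p1 (R : realType) (V : gw_theory R)
    (string : string_equation V) (dilaton : dilaton_equation V)
    (hori : hori_equation V) (trr : topological_recursion V) :
  Psi01 V = 0.
Proof.
have metric_unit : Defs.eta V \in unitmx by exact: poincare_duality.
pose A := (fps (nat * 'I_(nbasis V).+1)%type (novikov (omega V)) : comAlgType rat).
pose D : _ -> {linear A -> A} := @tau_deriv R V.
pose ev : {lrmorphism A -> novikov (omega V)} := @const_coef _ _.
have L1 := @L1_constraint_eq0 (nbasis V) A (novikov (omega V)) (Defs.eta V)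
  (eta_sym V) metric_unit D ev (@fpsX _ _) (@shifted_sum _ _ (dilaton_index _))
  (@fps_derivM _ _) (@fps_deriv_comm _ _) (@fps_derivX _ _)
  (@fps_deriv_eq0 _ _) (@deriv_shifted_sum _ _ _) (@const_coef_shifted_sum _ _ _)
  (@shifted_sum_sum _ _ _) (@shifted_sumMr _ _ _) (F0 V).
apply: etrans (L1 _ _ _).
- apply: (congr2 (fun x y : A => - x + (1 / 2 : rat) *: y)).
    exact: shifted_sum_tau (@tau_succ R V ^~ _).
  exact: metric_pairing_Oup.
- apply: etrans string; apply/esym.
  exact: shifted_sum_tau (@tau_pred R V ^~ _).
- apply: etrans dilaton; apply/esym.
  apply: etrans (fps_sum_tt (fun i => tau i.1 i.2 (F0 V))) _.
  by apply: congr1; apply/funext => i; apply: tau_nat.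
move=> [m a] [p b] [q c]; apply: etrans (trr m.+1 p q a b c isT) _.
apply: eq_bigr => s _; apply: (congr1 (fun f : A => f * _)).
apply: etrans (tau_pred (raise (m, a)) _) _.
exact: fps_deriv_comm.
Qed.
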